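(* Let $\mathcal I=(H,\varkappa)$ be a $\varkappa$-interacting Fock space. Then: 1. For $x\in H$, the creator $a^*(x)$ is bounded if and only if there exists a constant $M_x$ such that $\|\varkappa(x\otimes X)\|\le M_x\|X\|$ for all $X\in\mathcal D_{\mathcal I}$. 2. The creator map $a^*$ is bounded if and only if there exists a constant $M$ such that $\|\varkappa(x\otimes X)\|\le M\|x\|\,\|X\|$ for all $x\in H$ and $X\in\mathcal D_{\mathcal I}$.
   Context: All vector spaces are complex; direct sums and tensor products of pre-Hilbert spaces are algebraic; $\overline V$ is the completion of a pre-Hilbert space $V$; $\mathscr L(V)$ is the space of all linear maps $V\to V$. $H$ is a pre-Hilbert space and $\mathscr F(H)=\Omega\mathbb C\oplus\bigoplus_{n\ge1}H^{\otimes n}$ is the algebraic full Fock space with natural inner product, $\Omega$ a unit vector; $\ell^*(x)\colon X\mapsto x\otimes X$ (with $x\otimes\Omega=x$) for $x\in H$. A pre-Fock subspace of $\overline{\mathscr F(H)}$ is an algebraic direct sum $\mathcal I=\bigoplus_{n\in\mathbb N_0}H_n$ of subspaces $H_n\subset\overline{H^{\otimes n}}$ with $H_0=\Omega\mathbb C$; $\mathcal D_{\mathcal I}:=\mathcal I\oplus\mathcal I^\perp\subset\overline{\mathscr F(H)}$. A squeezing relative to $\mathcal I$ is a linear map $\varkappa\colon(H\otimes\mathcal D_{\mathcal I})\oplus\Omega\mathbb C\to\mathcal D_{\mathcal I}$ with $\varkappa\Omega=\Omega$, preserving degree (elements of $\overline{H^{\otimes n}}$ go to $\overline{H^{\otimes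 n}}$), with range $\mathcal I$ and vanishing on $H\otimes\mathcal I^\perp$. The $\varkappa$-interacting Fock space $(H,\varkappa)$ is $\mathcal I$ together with the creator map $a^*\colon H\to\mathscr L(\mathcal I)$, where $a^*(x)$ is the (co)restriction of $\varkappa\ell^*(x)$ to $\mathcal I$. The creator map $a^*$ is bounded if all $a^*(x)$ are bounded and $x\mapsto a^*(x)$ is bounded with respect to the operator norm. *)

(* Defs.v *)
From HB Require Import structures.
From mathcomp Require Import all_boot all_order all_algebra.
From mathcomp Require Import sesquilinear complex.
From mathcomp Require Import boolp classical_sets reals topology normedtype.

Set Implicit Arguments.
Unset Strict Implicit.
Unset Printing Implicit Defensive.

Import Order.TTheory GRing.Theory Num.Theory.
Import numFieldNormedType.Exports.

Local Open Scope classical_set_scope.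
Local Open Scope complex_scope.
Local Open Scope ring_scope.

(* As in [sesquilinear], inner products are linear in the first variable and
   conjugate-linear in the second one. *)
HB.mixin Record NormedModule_isPreHilbert (R : realType) V
    of NormedModule R[i] V := {
  inner : {dot V for (@Num.conj R[i])} ;
  sqr_normE : forall x : V, `|x| ^+ 2 = inner x x }.

#[short(type="preHilbertType")]
HB.structure Definition PreHilbert (R : realType) :=
  {V of NormedModule R[i] V & NormedModule_isPreHilbert R V}.

#[short(type="hilbertType")]
HB.structure Definition Hilbert (R : realType) :=
  {V of PreHilbert R V & CompleteNormedModule R[i] V}.

Section Subspaces.
Variables (K : pzRingType) (V : lmodType K).
Implicit Types A B : set V.

Definition subspace A : Prop := submod_closed [in A].
Definition lspan A : set V := smallest subspace A.
Definition subspace_add A B : set V := [set X + Y | X in A & Y in B].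

Lemma lspan_subspace A : subspace (lspan A).
Proof.
split=> [|a x y].
  by rewrite inE => B [[B0 _] _]; move: B0; rewrite inE.
rewrite !inE => xA yA B [sB AB].
have [_ /(_ a x y)] := sB; rewrite !inE; apply.
  exact: xA.
exact: yA.
Qed.

End Subspaces.

Section Orthogonal.
Variables (R : realType) (V : preHilbertType R).

Definition orthocomplement (A : set V) : set V :=
  [set X | forall Y, A Y -> inner X Y = 0].

End Orthogonal.

(* The completion of the algebraic full Fock space over H, given up to unitary
   equivalence. [tensor x X] is x (x) X, i.e. l^*(x) X, with l^*(x) extended by
   continuity to the completion. Iterating [tensor_inner], [tensor_vacuum] and
   [vacuum_inner] gives the natural inner product (see [elementary_inner]),
   which is positive definite on the algebraic tensor powers of H: the span of
   the elementary tensors of length n is therefore the algebraic H^{(x) n}, and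
   the range in [fock_dense] spans the algebraic Fock space. For the same reason
   the map from the algebraic tensor product of H and A induced by [tensor] is
   injective for every subspace A of the completion. *)
Record fockSpace (R : realType) (H : preHilbertType R) := FockSpace {
  fock_carrier :> hilbertType R ;
  vacuum : fock_carrier ;
  tensor : {bilinear H -> fock_carrier -> fock_carrier} ;
  vacuum_inner : inner vacuum vacuum = 1 ;
  tensor_vacuum : forall x X, inner (tensor x X) vacuum = 0 ;
  tensor_inner : forall x y X Y,
    inner (tensor x X) (tensor y Y) = inner x y * inner X Y ;
  fock_dense : closure (lspan (range (foldr tensor vacuum))) = setT }.

Section InteractingFock.
Variables (R : realType) (H : preHilbertType R) (F : fockSpace H).

(* x_1 (x) ... (x) x_n; the empty one is the vacuum, [:: x] is identified with
   x (x) Omega. *)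
Definition elementary (s : seq H) : F := foldr (tensor F) (vacuum F) s.

Lemma elementary_inner (s t : seq H) :
  inner (elementary s) (elementary t) =
  (size s == size t)%:R * \prod_(p <- zip s t) inner p.1 p.2.
Proof.
elim: s t => [|x s IHs] [|y t] /=.
- by rewrite big_nil mulr1 vacuum_inner.
- rewrite mul0r hermC /= tensor_vacuum.
  by rewrite rmorph0 mulr0.
- by rewrite mul0r tensor_vacuum.
by rewrite tensor_inner IHs big_cons eqSS mulrCA.
Qed.

Definition tensor_power (n : nat) : set F :=
  lspan [set elementary s | s in [set s | size s = n]].

Definition tensor_span (A : set F) : set F :=
  lspan [set tensor F x X | x in setT & X in A].

Record preFock := PreFock {
  component :> nat -> set F ;
  component_subspace : forall n, subspace (component n) ;
  component_closure : forall n, component n `<=` closure (tensor_power n) ;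
  component0 : component 0%N = lspan [set vacuum F] }.

(* Finite sums; they are direct since the components are pairwise orthogonal. *)
Definition prefock_space (I : preFock) : set F :=
  [set X | exists (N : nat) (Y : nat -> F),
     (forall n, I n (Y n)) /\ X = \sum_(n < N) Y n].

Definition squeeze_codom (I : preFock) : set F :=
  subspace_add (prefock_space I) (orthocomplement (prefock_space I)).

Definition squeeze_dom (I : preFock) : set F :=
  subspace_add (tensor_span (squeeze_codom I)) (lspan [set vacuum F]).

(* The values of a squeezing outside [squeeze_dom I] are irrelevant. *)
Record squeezing (I : preFock) := Squeezing {
  squeeze :> F -> F ;
  squeeze_linear : forall (a : R[i]) (X Y : F),
    squeeze_dom I X -> squeeze_dom I Y ->
    squeeze (a *: X + Y) = a *: squeeze X + squeeze Y ;
  squeeze_vacuum : squeeze (vacuum F) = vacuum F ;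
  squeeze_degree : forall (n : nat) (X : F),
    squeeze_dom I X -> closure (tensor_power n) X ->
    closure (tensor_power n) (squeeze X) ;
  squeeze_range : squeeze @` squeeze_dom I = prefock_space I ;
  squeeze_vanish : forall X : F,
    tensor_span (orthocomplement (prefock_space I)) X -> squeeze X = 0 }.

Definition bounded_on (A : set F) (T : F -> F) : Prop :=
  exists M : R, forall X, A X -> `|T X| <= M%:C * `|X|.

(* The norm takes its values in R[i], hence the real part. *)
Definition opnorm_on (A : set F) (T : F -> F) : R :=
  sup [set complex.Re `|T X| | X in [set X | A X /\ `|X| <= 1]].

Variables (I : preFock) (kappa : squeezing I).

(* To be considered as a map on [prefock_space I], see [creator_stable] and
   [creator_linear]. *)
Definition creator (x : H) (X : F) : F := kappa (tensor F x X).

Lemma prefock_squeeze_codom X : prefock_space I X -> squeeze_codom I X.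
Proof.
move=> IX; exists X => //; exists 0; last by rewrite addr0.
by move=> Y _; rewrite linear0l.
Qed.

Lemma tensor_squeeze_dom x X :
  squeeze_codom I X -> squeeze_dom I (tensor F x X).
Proof.
move=> DX; exists (tensor F x X).
  by move=> B [_]; apply; exists x => //; exists X.
exists 0; last by rewrite addr0.
by have [+ _] := lspan_subspace [set vacuum F]; rewrite inE.
Qed.

Lemma creator_stable x X : prefock_space I X -> prefock_space I (creator x X).
Proof.
move=> /prefock_squeeze_codom DX; rewrite -(squeeze_range kappa).
by exists (tensor F x X) => //; exact: tensor_squeeze_dom.
Qed.

Lemma creator_linear x (a : R[i]) X Y :
  prefock_space I X -> prefock_space I Y ->
  creator x (a *: X + Y) = a *: creator x X + creator x Y.
Proof.
move=> /prefock_squeeze_codom DX /prefock_squeeze_codom DY.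
rewrite /creator linearDr linearZr_LR squeeze_linear//.
  exact: tensor_squeeze_dom.
exact: tensor_squeeze_dom.
Qed.

Definition bounded_creator (x : H) : Prop :=
  bounded_on (prefock_space I) (creator x).

Definition bounded_creator_map : Prop :=
  (forall x, bounded_creator x) /\
  exists M : R, forall x,
    (opnorm_on (prefock_space I) (creator x))%:C <= M%:C * `|x|.

End InteractingFock.

(* Main.v *)
Require Import Defs.
From mathcomp Require Import all_boot all_order all_algebra.
From mathcomp Require Import sesquilinear complex.
From mathcomp Require Import boolp classical_sets reals topology normedtype.

(** A vector of the domain I (+) I^perp splits as X = Y + Z with Y in I and Z
orthogonal to I. Since the squeezing vanishes on H (x) I^perp, it sends
x (x) X to the value at Y of the creator of x ([squeeze_tensorD]), while
Pythagoras gives |Y| <= |X| ([ler_norm_orthoD]). A bound for the creator on I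
is therefore the same thing as a bound, with the same nonnegative constant, for
X |-> kappa (x (x) X) on the whole domain ([squeeze_tensor_bound]); the
converse direction is restriction to I. This settles the first equivalence.

For the second one, the operator norm of a bounded homogeneous map is its least
bound: it is below every nonnegative bound ([opnorm_on_le]) and is itself one
([opnorm_on_bound]). The estimate of the operator norm of the creator of x by
M |x| is thus the pointwise estimate with constant M |x| on I, to which the
first part applies for each x separately. Bounding constants are not required
to be nonnegative, so they are replaced by their absolute values. *)

Set Implicit Arguments.
Unset Strict Implicit.
Unset Printing Implicit Defensive.

Import Order.TTheory GRing.Theory Num.Theory.

Local Open Scope classical_set_scope.
Local Open Scope complex_scope.
Local Open Scope ring_scope.

(** * Norms in a pre-Hilbert space *)

Section Norm.
Context {R : realType}.

Lemma Re_normK (V : normedModType R[i]) (X : V) :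
  (complex.Re `|X|)%:C = `|X|.
Proof. by apply: RRe_real; exact: normr_real. Qed.

Lemma Re_norm_ge0 (V : normedModType R[i]) (X : V) : 0 <= complex.Re `|X|.
Proof. by rewrite -(@lecR R) Re_normK; exact: normr_ge0. Qed.

Lemma ler_norm_orthoD (V : preHilbertType R) (Y Z : V) :
  inner Z Y = 0 -> `|Y| <= `|Y + Z|.
Proof.
move=> ZY0; rewrite -(@ler_pXn2r _ 2) ?nnegrE ?normr_ge0 //.
have YZ0 : inner Y Z = 0 by rewrite hermC /= ZY0 rmorph0 mulr0.
rewrite !sqr_normE linearDl /= !linearDr /= ZY0 YZ0 addr0 add0r lerDl.
by rewrite -sqr_normE exprn_ge0.
Qed.

End Norm.

(** * Operator norms *)

Section OperatorNorm.
Context {R : realType} {H : preHilbertType R} {F : fockSpace H}.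
Variables (A : set F) (T : F -> F).

Lemma bounded_on_nonneg :
  bounded_on A T ->
  exists2 M : R, 0 <= M & forall X, A X -> `|T X| <= M%:C * `|X|.
Proof.
move=> [M TM]; exists `|M| => // X AX.
by apply: (le_trans (TM X AX)); rewrite ler_wpM2r // lecR ler_norm.
Qed.

Lemma opnorm_on_le (M : R) :
  A 0 -> 0 <= M -> (forall X, A X -> `|T X| <= M%:C * `|X|) ->
  opnorm_on A T <= M.
Proof.
move=> A0 M0 TM; apply: ge_sup.
  by exists (complex.Re `|T 0|), 0 => //; split=> //; rewrite normr0.
move=> _ [X [AX X1] <-]; rewrite -(@lecR R) Re_normK.
by apply: (le_trans (TM X AX)); rewrite ler_piMr // lecR.
Qed.

Hypothesis scaleA : forall (a : R[i]) X, A X -> A (a *: X).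
Hypothesis scaleT : forall (a : R[i]) X, A X -> T (a *: X) = a *: T X.

(** The supremum over the unit ball controls every vector by normalisation.
Boundedness matters here: the supremum of an unbounded set is a default
value. *)
Lemma opnorm_on_bound :
  bounded_on A T ->
  forall X, A X -> `|T X| <= (opnorm_on A T)%:C * `|X|.
Proof.
move=> /bounded_on_nonneg[M M0 TM] X AX.
have [X0|X0] := eqVneq X 0.
  by have := TM X AX; rewrite X0 normr0 !mulr0.
have nX : 0 < `|X| by rewrite normr_gt0.
pose U := `|X|^-1 *: X.
have AU : A U by exact: scaleA.
have nU : `|U| = 1 by rewrite normrZ normfV normr_id mulVf ?gt_eqF.
have -> : `|T X| = `|T U| * `|X|.
  by rewrite /U scaleT // normrZ normfV normr_id mulrAC mulVf ?mul1r ?gt_eqF.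
rewrite ler_wpM2r // -Re_normK lecR; apply: ub_le_sup.
  exists M => _ [Y [AY Y1] <-]; rewrite -(@lecR R) Re_normK.
  by apply: (le_trans (TM Y AY)); rewrite ler_piMr // lecR.
by exists U => //; split=> //; rewrite nU.
Qed.

End OperatorNorm.

(** * Squeezings and creators *)

Section Creator.
Context {R : realType} {H : preHilbertType R} {F : fockSpace H}.
Context {I : preFock F} (kappa : squeezing I).

Lemma prefock_space0 : prefock_space I 0.
Proof.
exists 0%N, (fun=> 0); split; last by rewrite big_ord0.
by move=> n; have [+ _] := component_subspace I n; rewrite inE.
Qed.

Lemma prefock_spaceZ (a : R[i]) X :
  prefock_space I X -> prefock_space I (a *: X).
Proof.
move=> [N [Y [IY ->]]]; exists N, (fun n => a *: Y n); split=> [n|].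
  have [I0 /(_ a (Y n) 0)] := component_subspace I n.
  rewrite !inE addr0; apply; first exact: IY.
  by move: I0; rewrite inE.
by rewrite scaler_sumr.
Qed.

Lemma squeeze_tensor_ortho x Z :
  orthocomplement (prefock_space I) Z -> kappa (tensor F x Z) = 0.
Proof.
move=> IZ; apply: squeeze_vanish => B [_]; apply.
by exists x => //; exists Z.
Qed.

Lemma squeeze_tensorD x Y Z :
  prefock_space I Y -> orthocomplement (prefock_space I) Z ->
  kappa (tensor F x (Y + Z)) = creator kappa x Y.
Proof.
move=> IY IZ; rewrite linearDr -[tensor F x Y]scale1r squeeze_linear.
- by rewrite scale1r (squeeze_tensor_ortho x IZ) addr0.
- by apply: tensor_squeeze_dom; exact: prefock_squeeze_codom.
- apply: tensor_squeeze_dom; exists 0; first exact: prefock_space0.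
  by exists Z => //; rewrite add0r.
Qed.

Lemma creatorZ x (a : R[i]) X :
  prefock_space I X -> creator kappa x (a *: X) = a *: creator kappa x X.
Proof.
move=> IX; rewrite -[a *: X]addr0 creator_linear //; last exact: prefock_space0.
rewrite [creator kappa x 0]squeeze_tensor_ortho ?addr0 // => Y _.
by rewrite linear0l.
Qed.

(** The orthogonal part of X contributes nothing to the left-hand side and can
only increase the norm of X. *)
Lemma squeeze_tensor_bound x (c : R[i]) :
  0 <= c ->
  (forall Y, prefock_space I Y -> `|creator kappa x Y| <= c * `|Y|) ->
  forall X, squeeze_codom I X -> `|kappa (tensor F x X)| <= c * `|X|.
Proof.
move=> c0 bnd _ [Y IY [Z IZ <-]]; rewrite squeeze_tensorD //.
apply: (le_trans (bnd Y IY)); rewrite ler_wpM2l // ler_norm_orthoD //.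
exact: IZ.
Qed.

Lemma bounded_creatorP x :
  bounded_creator kappa x <->
  exists M : R, forall X, squeeze_codom I X ->
    `|kappa (tensor F x X)| <= M%:C * `|X|.
Proof.
split=> [/bounded_on_nonneg[M M0 bnd]|[M bnd]]; exists M.
  by apply: squeeze_tensor_bound => //; rewrite lecR.
by move=> X /prefock_squeeze_codom; exact: bnd.
Qed.

Lemma bounded_creator_mapP :
  bounded_creator_map kappa <->
  exists M : R, forall x X, squeeze_codom I X ->
    `|kappa (tensor F x X)| <= M%:C * `|x| * `|X|.
Proof.
split=> [[bnd [M normM]]|[M bnd]].
  exists `|M| => x; apply: squeeze_tensor_bound => [|Y IY].
    by rewrite mulr_ge0 // lecR.
  apply: le_trans (opnorm_on_bound prefock_spaceZ (creatorZ x) (bnd x) IY) _.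
  rewrite ler_wpM2r //; apply: (le_trans (normM x)).
  by rewrite ler_wpM2r // lecR ler_norm.
have bndI x Y : prefock_space I Y ->
    `|creator kappa x Y| <= (`|M| * complex.Re `|x|)%:C * `|Y|.
  move=> /prefock_squeeze_codom /(bnd x) /le_trans; apply.
  by rewrite rmorphM /= Re_normK !ler_wpM2r // lecR ler_norm.
split=> [x|]; first by exists (`|M| * complex.Re `|x|) => Y; exact: bndI.
exists `|M| => x; rewrite -[`|x|]Re_normK -rmorphM lecR.
apply: opnorm_on_le; first exact: prefock_space0.
  by rewrite mulr_ge0 // Re_norm_ge0.
exact: bndI.
Qed.

End Creator.

Theorem theorem6p4 (R : realType) (H : preHilbertType R) (F : fockSpace H)
    (I : preFock F) (kappa : squeezing I) :
  (forall x : H,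
     bounded_creator kappa x <->
     exists Mx : R, forall X : F, squeeze_codom I X ->
       `|kappa (tensor F x X)| <= Mx%:C * `|X|)
  /\
  (bounded_creator_map kappa <->
   exists M : R, forall (x : H) (X : F), squeeze_codom I X ->
     `|kappa (tensor F x X)| <= M%:C * `|x| * `|X|).
Proof.
by split; [move=> x; exact: bounded_creatorP | exact: bounded_creator_mapP].
Qed.
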